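(* Let $H\in\mathbb{C}^{M\times N}$, $M\ge N$, have full column rank, let $E_s,N_0>0$, $\beta=E_s/N_0$, and $1\le\nu\le N-1$. Let $y=Hx+n$ with $x\sim\mathcal{CN}(0,E_sI_N)$ and $n\sim\mathcal{CN}(0,N_0I_M)$ independent. Let $H=QL$ be the thin QL decomposition, let $W_p$ be the puncturing matrix of order $\nu$ of $L$, and $L_p=W_pL$. Set $F_p=\frac1{N_0}QW_p^\dagger L_p$, $G_p=\frac1{N_0}L_p^\dagger L_p$, and define the WLD detection model $$p_p(y|x)=\exp\!\big(2\,\mathrm{Re}\{y^\dagger F_px\}-x^\dagger G_px\big),\qquad p_p(y)=\int_{\mathbb{C}^N}p_p(y|x)p(x)\,dx,$$ where $p(x)=\frac{1}{\pi^NE_s^N}\exp(-\|x\|^2/E_s)$. Then the lower bound on the achievable information rate of the WLD detector, $$I_{LB}^{WLD}=\mathsf{E}_{Y,X}[\ln p_p(y|x)]-\mathsf{E}_Y[\ln p_p(y)],$$ is given by $$I_{LB}^{WLD}=\ln\det\!\big(I+\beta L_p^\dagger L_p\big)-\mathrm{Tr}\!\Big((I-W_pW_p^\dagger)\,(I+\beta L_pL_p^\dagger)^{-1}\Big).$$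
   Context: $(\cdot)^\dagger$ is the conjugate transpose; $\mathcal{CN}$ is the circularly-symmetric complex Gaussian distribution; expectations are over the true joint law of $(x,y)$ with $H$ fixed. $\mathrm{diag}(A)$ denotes the diagonal matrix with the same diagonal entries as $A$. Thin QL decomposition: $H=QL$ with $Q\in\mathbb{C}^{M\times N}$, $Q^\dagger Q=I_N$, and $L\in\mathbb{C}^{N\times N}$ lower triangular with real positive diagonal entries. Puncturing matrix of order $\nu$: partition $L=\begin{bmatrix}P&0\\R&S\end{bmatrix}$ with $P$ of size $\nu\times\nu$ and $S$ of size $(N-\nu)\times(N-\nu)$, put $\Omega=\mathrm{diag}(S^{-1}S^{-\dagger})^{-1/2}$, and $$W_p=\begin{bmatrix}I_\nu&0\\0&\Omega S^{-1}\end{bmatrix},\qquad L_p=W_pL=\begin{bmatrix}P&0\\ \Omega S^{-1}R&\Omega\end{bmatrix}.$$ (Thus all diagonal entries of $W_pW_p^\dagger$ equal $1$.) *)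

(* Defs.v *)
From HB Require Import structures.
From mathcomp Require Import all_boot all_order all_algebra.
From mathcomp Require Import complex.
From mathcomp Require Import all_classical all_reals all_analysis.

Set Implicit Arguments.
Unset Strict Implicit.
Unset Printing Implicit Defensive.

Import Order.TTheory GRing.Theory Num.Theory.
Import numFieldNormedType.Exports.

Local Open Scope classical_set_scope.
Local Open Scope ring_scope.
Local Open Scope complex_scope.
Local Open Scope sesquilinear_scope.

(* C^n with its Borel sigma-algebra, i.e. the one generated by the real and
   imaginary parts of the coordinates. *)
Definition cvec (R : realType) (n : nat) : Type := 'cV[R[i]]_n.

Definition cvec_display : measure_display. Proof. exact: default_measure_display. Qed.

Section cvec_measurable.
Context {R : realType}.
Variable n : nat.

HB.instance Definition _ := Choice.on (cvec R n).
HB.instance Definition _ := isPointed.Build (cvec R n) (0 : 'cV[R[i]]_n).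

Definition cvec_coord (i : 'I_n) (z : cvec R n) :
    measurableTypeR R * measurableTypeR R :=
  let c := (z : 'cV[R[i]]_n) i 0 in (complex.Re c, complex.Im c).

Let cvec_set0 : g_sigma_preimage cvec_coord set0.
Proof. exact: sigma_algebra0. Qed.

Let cvec_setC A : g_sigma_preimage cvec_coord A -> g_sigma_preimage cvec_coord (~` A).
Proof. exact: sigma_algebraC. Qed.

Let cvec_bigcup (F : (set (cvec R n))^nat) :
  (forall i, g_sigma_preimage cvec_coord (F i)) ->
  g_sigma_preimage cvec_coord (\bigcup_i (F i)).
Proof. exact: sigma_algebra_bigcup. Qed.

HB.instance Definition _ := @isMeasurable.Build cvec_display
  (cvec R n) (g_sigma_preimage cvec_coord) cvec_set0 cvec_setC cvec_bigcup.

End cvec_measurable.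

Section lebesgue_cvec.
Context {R : realType}.

Lemma measurable_cvec_coord n (i : 'I_n) :
  measurable_fun [set: cvec R n] (cvec_coord i).
Proof.
move=> _ Y mY; rewrite setTI; apply: sub_sigma_algebra => /=.
rewrite -bigcup_seq/=; exists i => /=; first by rewrite mem_index_enum.
by exists Y => //; rewrite setTI.
Qed.

Lemma measurable_fun_cvec d (T : measurableType d) n (f : T -> cvec R n) :
  (forall i, measurable_fun [set: T] (cvec_coord i \o f)) ->
  measurable_fun [set: T] f.
Proof.
move=> mf; apply: (@measurability _ _ _ _ _ _
  (\big[setU/set0]_(i < n) preimage_set_system setT (@cvec_coord R n i) measurable)) => //.
move=> _ [A + <-]; rewrite -bigcup_seq/= => -[i _ [B mB <-]].
by rewrite !setTI -comp_preimage -[X in measurable X]setTI; exact: mf.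
Qed.

Definition cvec_cons n (p : (measurableTypeR R * measurableTypeR R) * cvec R n) :
    cvec R n.+1 :=
  col_mx (const_mx (p.1.1 +i* p.1.2) : 'cV[R[i]]_1) (p.2 : 'cV[R[i]]_n).

Definition cvec_uncons n (z : cvec R n.+1) :
    (measurableTypeR R * measurableTypeR R) * cvec R n :=
  (cvec_coord ord0 z, dsubmx (z : 'cV[R[i]]_(1 + n))).

Let col_mx_ord0 n (u : 'cV[R[i]]_1) (v : 'cV[R[i]]_n) :
  (col_mx u v : 'cV[R[i]]_(1 + n)) (ord0 : 'I_n.+1) 0 = u 0 0.
Proof.
by rewrite -(col_mxEu u v); congr (fun_of_matrix _ _ _); exact/val_inj.
Qed.

Lemma cvec_consK n : cancel (@cvec_cons n) (@cvec_uncons n).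
Proof.
move=> [[a b] v]; rewrite /cvec_uncons /cvec_cons /cvec_coord /=.
by rewrite col_mxKd col_mx_ord0 mxE.
Qed.

Lemma cvec_unconsK n : cancel (@cvec_uncons n) (@cvec_cons n).
Proof.
move=> z; rewrite /cvec_uncons /cvec_cons /cvec_coord /=.
rewrite (_ : const_mx _ = usubmx (z : 'cV[R[i]]_(1 + n))).
  exact: (vsubmxK (z : 'cV[R[i]]_(1 + n))).
apply/matrixP => i j; rewrite !mxE !ord1.
have <- : ord0 = lshift n (0 : 'I_1) :> 'I_n.+1 by exact/val_inj.
by case: (fun_of_matrix _ _ _).
Qed.

Lemma measurable_cvec_cons n :
  measurable_fun setT (@cvec_cons n).
Proof.
apply: measurable_fun_cvec => i.
have [->|[j ->]] : i = ord0 \/ exists j : 'I_n, i = rshift 1 j.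
- have [->|i0] := eqVneq i ord0; [by left|right].
  have i1n : (i.-1 < n)%N by rewrite prednK ?lt0n// -ltnS.
  exists (Ordinal i1n); apply/val_inj => /=.
  by rewrite add1n prednK// lt0n.
- rewrite (_ : _ \o _ = fst)//; apply/funext => -[[a b] v] /=.
  by rewrite /cvec_cons /cvec_coord /= col_mx_ord0 mxE.
- rewrite (_ : _ \o _ = cvec_coord j \o snd).
    by apply: measurableT_comp => //; exact: measurable_cvec_coord.
  apply/funext => -[[a b] v] /=.
  by congr (complex.Re _, complex.Im _); exact: col_mxEd.
Qed.

Lemma measurable_cvec_uncons n :
  measurable_fun setT (@cvec_uncons n).
Proof.
apply: measurable_fun_pair; first exact: measurable_cvec_coord.
apply: measurable_fun_cvec => i.
rewrite (_ : _ \o _ = cvec_coord (rshift 1 i)).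
  exact: measurable_cvec_coord.
by apply/funext => z; rewrite /cvec_coord /= !mxE.
Qed.

Local Open Scope ereal_scope.

Let sigma_finite_product d1 d2 (T1 : measurableType d1) (T2 : measurableType d2)
    (m1 : {sigma_finite_measure set T1 -> \bar R})
    (m2 : {sigma_finite_measure set T2 -> \bar R}) :
  sigma_finite setT (m1 \x m2).
Proof.
have /sigma_finiteP[F [TF ndF Foo]] := sigma_finiteT m1.
have /sigma_finiteP[G [TG ndG Goo]] := sigma_finiteT m2.
exists (fun n => F n `*` G n).
  rewrite -setXTT TF TG predeqE => -[x y]; split.
    move=> [/= [n _ Fnx] [k _ Gky]]; exists (maxn n k) => //; split.
    - by move: x Fnx; exact/subsetPset/ndF/leq_maxl.
    - by move: y Gky; exact/subsetPset/ndG/leq_maxr.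
  by move=> [n _ []/= ? ?]; split; exists n.
move=> k; have [? ?] := Foo k; have [? ?] := Goo k.
split; first exact: measurableX.
by rewrite product_measure1E// lte_mul_pinfty// ge0_fin_numE.
Qed.

Definition lebesgue_plane : set (measurableTypeR R * measurableTypeR R) -> \bar R :=
  lebesgue_measure \x lebesgue_measure.

HB.instance Definition _ := Measure.on lebesgue_plane.

HB.instance Definition _ := Measure_isSigmaFinite.Build _ _ _ lebesgue_plane
  (sigma_finite_product lebesgue_measure lebesgue_measure).

Section lebesgue_cvecS.
Variables (n : nat) (mu : {sigma_finite_measure set (cvec R n) -> \bar R}).

Definition lebesgue_cvecS : set (cvec R n.+1) -> \bar R :=
  pushforward (lebesgue_plane \x mu) (@cvec_cons n).

Let lebesgue_cvecS0 : lebesgue_cvecS set0 = 0.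
Proof. by rewrite /lebesgue_cvecS /pushforward preimage_set0 measure0. Qed.

Let lebesgue_cvecS_ge0 A : 0 <= lebesgue_cvecS A.
Proof. by rewrite /lebesgue_cvecS /pushforward; exact: measure_ge0. Qed.

Let lebesgue_cvecS_sigma_additive : semi_sigma_additive lebesgue_cvecS.
Proof.
move=> F mF tF mUF; rewrite /lebesgue_cvecS /pushforward preimage_bigcup.
have mpre A : measurable A -> measurable (@cvec_cons n @^-1` A).
  by move=> mA; rewrite -[X in measurable X]setTI; exact: measurable_cvec_cons.
apply: measure_semi_sigma_additive.
- by move=> k; exact: mpre.
- apply/trivIsetP => /= i j _ _ ij; rewrite -preimage_setI.
  by move/trivIsetP : tF => /(_ _ _ _ _ ij) ->//; rewrite preimage_set0.
- by rewrite -preimage_bigcup; exact: mpre.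
Qed.

HB.instance Definition _ := isMeasure.Build _ _ _ lebesgue_cvecS
  lebesgue_cvecS0 lebesgue_cvecS_ge0 lebesgue_cvecS_sigma_additive.

Let lebesgue_cvecS_sigma_finite : sigma_finite setT lebesgue_cvecS.
Proof.
have [F FT Foo] := sigma_finite_product lebesgue_plane mu.
exists (fun k => @cvec_uncons n @^-1` F k).
  by rewrite -preimage_bigcup -FT preimage_setT.
move=> k; have [mF Fk] := Foo k; split.
  by rewrite -[X in measurable X]setTI; exact: measurable_cvec_uncons.
rewrite /lebesgue_cvecS /pushforward -comp_preimage.
by rewrite (_ : _ \o _ = id)// funeqE; exact: cvec_consK.
Qed.

HB.instance Definition _ := Measure_isSigmaFinite.Build _ _ _ lebesgue_cvecS
  lebesgue_cvecS_sigma_finite.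

End lebesgue_cvecS.

(* Lebesgue measure on C^n = R^(2n), transported coordinate by coordinate along
   C * C^n -> C^(n+1); one complex coordinate carries d(Re) d(Im). *)
Fixpoint lebesgue_cvec (n : nat) :
    {sigma_finite_measure set (cvec R n) -> \bar R} :=
  if n is m.+1 then [the {sigma_finite_measure set _ -> \bar R} of
    lebesgue_cvecS (lebesgue_cvec m)]
  else [the {sigma_finite_measure set _ -> \bar R} of @dirac _ (cvec R 0) point R].

End lebesgue_cvec.

Section complex_gaussian.
Context {R : realType} {d} {T : measurableType d} (P : probability T R).

(* Density of CN(0, Sigma) on C^n, for Sigma Hermitian positive definite. The
   quadratic form and the determinant are then real, which is why taking real
   parts loses nothing. *)
Definition cn_density n (Sigma : 'M[R[i]]_n) (z : 'cV[R[i]]_n) : R :=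
  expR (- complex.Re ((z^t* *m invmx Sigma *m z) 0 0)) /
  (pi ^+ n * complex.Re (\det Sigma)).

Definition is_CN n (Z : {RV P >-> cvec R n}) (Sigma : 'M[R[i]]_n) : Prop :=
  forall A : set (cvec R n), measurable A ->
    distribution P Z A = (\int[lebesgue_cvec n]_(z in A) (cn_density Sigma z)%:E)%E.

Definition independent_RV n m (X : {RV P >-> cvec R n}) (Y : {RV P >-> cvec R m}) :
    Prop :=
  forall (A : set (cvec R n)) (B : set (cvec R m)), measurable A -> measurable B ->
    P (X @^-1` A `&` Y @^-1` B) = (P (X @^-1` A) * P (Y @^-1` B))%E.

End complex_gaussian.

Definition thin_QL (R : realType) M N (H Q : 'M[R[i]]_(M, N)) (L : 'M[R[i]]_N) : Prop :=
  [/\ H = Q *m L, Q^t* *m Q = 1%:M, is_trig_mx L & forall i, 0 < L i i].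

(* Omega = diag(S^-1 S^-dagger)^(-1/2), for the lower right k x k block S of L.
   The order nu of the puncturing is carried by the dimension nu + k of L. *)
Definition puncturing_mx (R : realType) nu k (L : 'M[R[i]]_(nu + k)) :
    'M[R[i]]_(nu + k) :=
  let S := drsubmx L in
  let Omega :=
    diag_mx (\row_i (sqrtC ((invmx S *m (invmx S)^t*) i i))^-1) in
  block_mx 1%:M 0 0 (Omega *m invmx S).

Section wld_model.
Context {R : realType} (M N : nat).
Variables (Es N0 : R) (Q : 'M[R[i]]_(M, N)) (L W : 'M[R[i]]_N).

Let Lp := W *m L.

Definition wld_F : 'M[R[i]]_(M, N) := (N0^-1)%:C *: (Q *m W^t* *m Lp).

Definition wld_G : 'M[R[i]]_N := (N0^-1)%:C *: (Lp^t* *m Lp).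

(* x^dagger G x is real since G is Hermitian. *)
Definition wld_cond (y : 'cV[R[i]]_M) (x : 'cV[R[i]]_N) : R :=
  expR (2 * complex.Re ((y^t* *m wld_F *m x) 0 0)
        - complex.Re ((x^t* *m wld_G *m x) 0 0)).

Definition wld_prior (x : 'cV[R[i]]_N) : R :=
  (pi ^+ N * Es ^+ N)^-1 * expR (- (complex.Re ((x^t* *m x) 0 0) / Es)).

(* The integral is finite for every y: G is positive semidefinite. *)
Definition wld_marginal (y : 'cV[R[i]]_M) : R :=
  fine (\int[lebesgue_cvec N]_x (wld_cond y x * wld_prior x)%:E)%E.

Definition wld_rate {d} {T : measurableType d} (P : probability T R)
    (Y : T -> 'cV[R[i]]_M) (X : T -> 'cV[R[i]]_N) : \bar R :=
  ('E_P[fun w => ln (wld_cond (Y w) (X w))] -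
   'E_P[fun w => ln (wld_marginal (Y w))])%E.

End wld_model.

(* Main.v *)
(* Up to a constant, ln p_p(y) is a quadratic form in y, so both expectations
   are those of real quadratic forms in the independent Gaussian vectors x, n.
   The Gaussian integral over C^n of exp(2 Re(b^dagger z) - z^dagger A z) is
   pi^n / det A * exp(b^dagger A^-1 b); it gives p_p(y) and also the moment
   generating functions of |u^dagger x|^2 and of Re((p^dagger n)^* q^dagger x),
   hence by polarization E[x^dagger C x] = Es tr C, E[n^dagger C n] = N0 tr C
   and E[Re(n^dagger C x)] = 0.  The push-through identity then collapses the
   traces to Tr((I - Wp Wp^dagger)(I - (I + beta Lp Lp^dagger)^-1)), whose first
   part vanishes because Wp Wp^dagger has unit diagonal. *)

Require Import Defs.
From HB Require Import structures.
From mathcomp Require Import all_boot all_order all_algebra.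
From mathcomp Require Import complex.
From mathcomp Require Import all_classical all_reals all_analysis.
From mathcomp Require Import measurable_realfun ring lra.

Import Order.TTheory GRing.Theory Num.Theory.
Import numFieldNormedType.Exports.

Local Open Scope classical_set_scope.
Local Open Scope ring_scope.
Local Open Scope complex_scope.
Local Open Scope sesquilinear_scope.

Set Implicit Arguments.
Unset Strict Implicit.
Unset Printing Implicit Defensive.

(** * Gaussian integrals over the real line and the plane *)

Section gaussian_plane.
Context {R : realType}.
Implicit Types a b c : R.

(** Completing the square turns the integrand into a constant times the normal density of mean
    [b / a] and variance [1 / (2 * a)], whose integral is 1. *)
Lemma integral_expR_quadratic a b : 0 < a ->
  (\int[lebesgue_measure]_(t in [set: measurableTypeR R])
     (expR (2 * (b * t) - a * t ^+ 2))%:E)%E =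
  (Num.sqrt (pi / a) * expR (b ^+ 2 / a))%:E.
Proof.
move=> a0.
pose s : R := Num.sqrt (2 * a)^-1.
have s2 : s ^+ 2 = (2 * a)^-1.
  by rewrite sqr_sqrtr// invr_ge0 mulr_ge0// ltW.
have s0 : s != 0.
  by rewrite sqrtr_eq0 -ltNge invr_gt0 mulr_gt0.
have peak : normal_peak s = (Num.sqrt (pi / a))^-1.
  rewrite /normal_peak s2; congr (Num.sqrt _)^-1.
  by rewrite -mulr_natl; field; rewrite gt_eqF.
have q0 : 0 < Num.sqrt (pi / a) by rewrite sqrtr_gt0 divr_gt0// pi_gt0.
under eq_integral => t _.
  rewrite (_ : expR _ = (Num.sqrt (pi / a) * expR (b ^+ 2 / a))
      * normal_pdf (b / a) s t); last first.
    rewrite normal_pdfE// peak mulrACA divff ?gt_eqF// mul1r /normal_fun -expRD.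
    congr expR; rewrite s2 -mulr_natr; field.
    by rewrite gt_eqF.
  rewrite EFinM.
over.
rewrite ge0_integralZl//=.
- by rewrite integral_normal_pdf mule1.
- by apply/measurable_EFinP; exact: measurable_normal_pdf.
- by move=> t _; rewrite lee_fin normal_pdf_ge0.
Qed.

(** The integrand is a product of a function of [p.1] and a function of [p.2], so Tonelli reduces it
    to two integrals over the line. *)
Lemma integral_expR_quadratic_plane a b c : 0 < a ->
  (\int[lebesgue_plane]_(p in [set: measurableTypeR R * measurableTypeR R])
     (expR (2 * (b * p.1 + c * p.2) - a * (p.1 ^+ 2 + p.2 ^+ 2)))%:E)%E =
  (pi / a * expR ((b ^+ 2 + c ^+ 2) / a))%:E.
Proof.
move=> a0.
rewrite /lebesgue_plane (fubini_tonelli1 (fun p : measurableTypeR R * measurableTypeR R =>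
  (expR (2 * (b * p.1 + c * p.2) - a * (p.1 ^+ 2 + p.2 ^+ 2)))%:E))/=; last 2 first.
- apply/measurable_EFinP; apply: measurableT_comp => //.
  by apply: measurable_funB; apply: measurable_funM => //;
    apply: measurable_funD => //; apply: measurable_funM => //.
- by move=> p; rewrite lee_fin expR_ge0.
have q0 : 0 <= Num.sqrt (pi / a) * expR (c ^+ 2 / a).
  by rewrite mulr_ge0 ?expR_ge0 ?sqrtr_ge0.
under eq_integral => x _.
  rewrite /fubini_F /=.
  under eq_integral => y _.
    rewrite (_ : expR _ = expR (2 * (b * x) - a * x ^+ 2) *
                          expR (2 * (c * y) - a * y ^+ 2)); last first.
      by rewrite -expRD; congr expR; ring.
    rewrite EFinM.
  over.
  rewrite ge0_integralZl//=; last first.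
    apply/measurable_EFinP; apply: measurableT_comp => //.
    by apply: measurable_funB; apply: measurable_funM => //; apply: measurable_funM.
  rewrite integral_expR_quadratic// muleC.
over.
rewrite ge0_integralZl//=; last first.
  apply/measurable_EFinP; apply: measurableT_comp => //.
  by apply: measurable_funB; apply: measurable_funM => //; apply: measurable_funM.
rewrite integral_expR_quadratic// -EFinM; congr EFin.
rewrite mulrACA -expr2 sqr_sqrtr ?divr_ge0 ?pi_ge0 ?ltW// -expRD.
by congr (_ * expR _); ring.
Qed.

End gaussian_plane.

(** * Hermitian forms and positive definite matrices *)

Section rdot.
Context {R : realType}.
Local Notation C := R[i].

Lemma ReD (x y : C) : complex.Re (x + y) = complex.Re x + complex.Re y.
Proof. by case: x; case: y. Qed.

Lemma ReN (x : C) : complex.Re (- x) = - complex.Re x.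
Proof. by case: x. Qed.

Lemma ReB (x y : C) : complex.Re (x - y) = complex.Re x - complex.Re y.
Proof. by rewrite ReD ReN. Qed.

Lemma ReZ (r : R) (x : C) : complex.Re (r%:C * x) = r * complex.Re x.
Proof. by case: x => a b /=; rewrite mul0r subr0. Qed.

Lemma Re_sum (I : Type) (r : seq I) (F : I -> C) :
  complex.Re (\sum_(i <- r) F i) = \sum_(i <- r) complex.Re (F i).
Proof. by apply: (big_morph (@complex.Re R)) => // x y; exact: ReD. Qed.

Lemma Re_conjM (x y : C) : complex.Re (x^* * y) =
  complex.Re x * complex.Re y + complex.Im x * complex.Im y.
Proof. by case: x => a b; case: y => c d /=; rewrite mulNr opprK. Qed.

Lemma conjC_real (r : R) : Num.conj (r%:C) = r%:C.
Proof. exact: conjc_real. Qed.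

Lemma adjmxM (K : numClosedFieldType) m n p (A : 'M[K]_(m, n)) (B : 'M[K]_(n, p)) :
  (A *m B)^t* = B^t* *m A^t*.
Proof. by rewrite trmx_mul map_mxM. Qed.

Lemma adjmxD m n (A B : 'M[C]_(m, n)) : (A + B)^t* = A^t* + B^t*.
Proof. by rewrite linearD map_mxD. Qed.

Lemma adjmxB m n (A B : 'M[C]_(m, n)) : (A - B)^t* = A^t* - B^t*.
Proof. by rewrite linearB map_mxB. Qed.

Lemma adjmxZ m n (r : R) (A : 'M[C]_(m, n)) : (r%:C *: A)^t* = r%:C *: A^t*.
Proof. apply/matrixP => i j; rewrite !mxE rmorphM; congr (_ * _); exact: conjC_real. Qed.

Lemma adjmx1 n : (1%:M : 'M[C]_n)^t* = 1%:M.
Proof. by rewrite trmx1 map_mx1. Qed.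

Lemma adjmx_scalar n (r : R) : (r%:C%:M : 'M[C]_n)^t* = r%:C%:M.
Proof. by rewrite tr_scalar_mx map_scalar_mx; congr (_%:M); exact: conjC_real. Qed.

(* The Euclidean inner product of C^n seen as R^(2n). *)
Definition rdot n (u v : 'cV[C]_n) : R := complex.Re ((u^t* *m v) 0 0).

Lemma rdotE n (u v : 'cV[C]_n) : rdot u v =
  \sum_i (complex.Re (u i 0) * complex.Re (v i 0)
          + complex.Im (u i 0) * complex.Im (v i 0)).
Proof.
rewrite /rdot mxE Re_sum; apply: eq_bigr => i _.
by rewrite !mxE -Re_conjM.
Qed.

Lemma rdotC n (u v : 'cV[C]_n) : rdot u v = rdot v u.
Proof. by rewrite !rdotE; apply: eq_bigr => i _; congr (_ + _); exact: mulrC. Qed.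

Lemma rdotDr n (u v w : 'cV[C]_n) : rdot u (v + w) = rdot u v + rdot u w.
Proof. by rewrite /rdot mulmxDr mxE ReD. Qed.

Lemma rdotNr n (u v : 'cV[C]_n) : rdot u (- v) = - rdot u v.
Proof. by rewrite /rdot mulmxN mxE ReN. Qed.

Lemma rdotBr n (u v w : 'cV[C]_n) : rdot u (v - w) = rdot u v - rdot u w.
Proof. by rewrite rdotDr rdotNr. Qed.

Lemma rdotZr n (r : R) (u v : 'cV[C]_n) : rdot u (r%:C *: v) = r * rdot u v.
Proof. by rewrite /rdot -scalemxAr mxE ReZ. Qed.

Lemma rdotDl n (u v w : 'cV[C]_n) : rdot (u + v) w = rdot u w + rdot v w.
Proof. by rewrite rdotC rdotDr !(rdotC w). Qed.

Lemma rdotBl n (u v w : 'cV[C]_n) : rdot (u - v) w = rdot u w - rdot v w.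
Proof. by rewrite rdotC rdotBr !(rdotC w). Qed.

Lemma rdotZl n (r : R) (u v : 'cV[C]_n) : rdot (r%:C *: u) v = r * rdot u v.
Proof. by rewrite rdotC rdotZr rdotC. Qed.

Lemma rdot0r n (u : 'cV[C]_n) : rdot u 0 = 0.
Proof. by rewrite /rdot mulmx0 mxE. Qed.

Lemma rdot0l n (u : 'cV[C]_n) : rdot 0 u = 0.
Proof. by rewrite rdotC rdot0r. Qed.

Lemma rdot_mulmx m n (A : 'M[C]_(m, n)) u v :
  rdot u (A *m v) = rdot (A^t* *m u) v.
Proof. by rewrite /rdot adjmxM trmxCK mulmxA. Qed.

(** Splits a quadratic form in the received vector into a signal part, a noise part and cross terms.
    Both [B] and its adjoint occur because [B] need not be Hermitian; each cross term will have mean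
    zero. *)
Lemma rdot_quadratic_affine m n (B : 'M[C]_m) (H : 'M[C]_(m, n)) x v :
  rdot (H *m x + v) (B *m (H *m x + v)) =
  rdot x (H^t* *m B *m H *m x)
  + (rdot v (B *m H *m x) + rdot v (B^t* *m H *m x)) + rdot v (B *m v).
Proof.
rewrite -!mulmxA (rdot_mulmx (H^t*)) (rdot_mulmx (B^t*)) !trmxCK.
move: (H *m x) => u; rewrite mulmxDr rdotDl !rdotDr (rdotC (B *m v) u).
move: (rdot u (B *m u)) (rdot u (B *m v)) (rdot v (B *m u)) (rdot v (B *m v)) => *.
by ring.
Qed.

Lemma rdot_col_mx m n (u1 v1 : 'cV[C]_m) (u2 v2 : 'cV[C]_n) :
  rdot (col_mx u1 u2) (col_mx v1 v2) = rdot u1 v1 + rdot u2 v2.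
Proof.
rewrite !rdotE big_split_ord; congr (_ + _); apply: eq_bigr => i _.
  by rewrite !col_mxEu.
by rewrite !col_mxEd.
Qed.

Lemma rdot_ge0 n (u : 'cV[C]_n) : 0 <= rdot u u.
Proof. by rewrite rdotE sumr_ge0// => i _; rewrite -!expr2 addr_ge0 ?sqr_ge0. Qed.

Lemma rdot_eq0 n (u : 'cV[C]_n) : (rdot u u == 0) = (u == 0).
Proof.
apply/idP/eqP => [|->]; last by rewrite rdot0r.
rewrite rdotE psumr_eq0 => [/allP u0|i _]; last first.
  by rewrite -!expr2 addr_ge0 ?sqr_ge0.
apply/colP => i; rewrite !mxE; move: (u0 i (mem_index_enum i)) => /=.
rewrite -!expr2 paddr_eq0 ?sqr_ge0// !sqrf_eq0.
by case: (u i 0) => a b /= /andP[/eqP -> /eqP ->].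
Qed.

Lemma rdot_gt0 n (u : 'cV[C]_n) : (0 < rdot u u) = (u != 0).
Proof. by rewrite lt0r rdot_ge0 andbT rdot_eq0. Qed.

Definition posdefmx n (A : 'M[C]_n) : Prop :=
  A^t* = A /\ forall z : 'cV[C]_n, z != 0 -> 0 < rdot z (A *m z).

(** Block elimination of the first coordinate, with [S] the Schur complement. It drives the
    inductions on the dimension, for determinants and for Gaussian integrals. *)
Lemma posdefmx_schur n (A : 'M[C]_(1 + n)) : posdefmx A ->
  exists a (r : 'rV[C]_n) (S : 'M[C]_n), [/\ 0 < a, posdefmx S,
    A = block_mx a%:C%:M r (r^t*) (S + a^-1%:C *: (r^t* *m r))
    & \det A = a%:C * \det S].
Proof.
move=> [Aherm Apos].
pose a := complex.Re (A 0 0); pose r := ursubmx A.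
pose S := drsubmx A - a^-1%:C *: (r^t* *m r).
have e0 : (0 : 'I_(1 + n)) = lshift n (0 : 'I_1) by exact/val_inj.
have A00 : ulsubmx A = a%:C%:M.
  apply/matrixP => i j; rewrite !ord1 !mxE eqxx mulr1n -e0 /a.
  have : (A^t*) 0 0 = A 0 0 by rewrite Aherm.
  (* A diagonal entry x + iy of a Hermitian matrix satisfies -y = y, hence is real. *)
  rewrite !mxE; case: (A 0 0) => x y /= [] /eqP; rewrite eq_sym -subr_eq0 opprK.
  by rewrite -mulr2n mulrn_eq0 => /eqP ->.
have Adl : dlsubmx A = r^t*.
  by rewrite -[in LHS]Aherm -[in LHS](submxK A) tr_block_mx map_block_mx block_mxKdl.
have AE : A = block_mx a%:C%:M r (r^t*) (S + a^-1%:C *: (r^t* *m r)).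
  by rewrite -[LHS]submxK A00 Adl subrK.
have a0 : 0 < a.
  have u0 : col_mx 1%:M 0 != 0 :> 'cV[C]_(1 + n).
    apply/eqP => /(congr1 usubmx); rewrite col_mxKu linear0 => /matrixP/(_ 0 0).
    by rewrite !mxE/= => /eqP; rewrite oner_eq0.
  have := Apos _ u0; rewrite AE mul_block_col !mulmx0 !addr0 rdot_col_mx mulmx1.
  rewrite [X in _ + X]rdotC rdot0r addr0 /rdot adjmx1 mul1mx mxE eqxx mulr1n/=.
  by [].
have Sherm : S^t* = S.
  rewrite /S adjmxB adjmxZ adjmxM trmxCK; congr (_ - _).
  by rewrite -[in RHS]Aherm -[in RHS](submxK A) tr_block_mx map_block_mx block_mxKdr.
exists a, r, S; split => //.
- split => // v v0.
  (* The first coordinate is chosen to annihilate the first row of [A *m w], so that the form at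
     this vector is exactly the form of [S] at [v]. *)
  have w0 : col_mx (- (a^-1%:C *: (r *m v))) v != 0 :> 'cV[C]_(1 + n).
    apply: contra v0 => /eqP/(congr1 dsubmx).
    by rewrite col_mxKd linear0 => ->.
  have := Apos _ w0; rewrite AE mul_block_col rdot_col_mx.
  rewrite mul_scalar_mx scalerN scalerA -rmorphM/= divff ?gt_eqF// scale1r addNr.
  rewrite rdot0r add0r mulmxN -scalemxAr mulmxDl -scalemxAl -mulmxA.
  by rewrite addrC addrK.
(* Block LU factorisation; the determinant is read off the triangular factors. *)
- have -> : A = block_mx 1%:M 0 (a^-1%:C *: r^t*) 1%:M *m block_mx a%:C%:M r 0 S.
    rewrite mulmx_block !mul1mx !mul0mx !addr0 mul_mx_scalar scalerA.
    rewrite -rmorphM/= divff ?gt_eqF// scale1r -scalemxAl.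
    by rewrite [in LHS]AE (addrC S).
  by rewrite det_mulmx det_lblock det_ublock !det1 !mul1r det_scalar1.
Qed.

(** Induction through Schur complements. Positivity in [R[i]] also says that the determinant is
    real. *)
Lemma posdefmx_det n (A : 'M[C]_n) : posdefmx A -> 0 < \det A.
Proof.
elim: n A => [A _|n IH A]; first by rewrite det_mx00.
move=> /posdefmx_schur[a [r [S [a0 /IH S0 _ ->]]]].
by rewrite mulr_gt0// ltcR.
Qed.

End rdot.

(** * Gaussian integrals over C^n *)

Section measurability.
Context {R : realType} {d} {T : measurableType d}.

Lemma measurable_Re_cvec n (f : T -> cvec R n) (i : 'I_n) :
  measurable_fun setT f ->
  measurable_fun setT (fun t => complex.Re ((f t : 'cV[R[i]]_n) i 0) : R).
Proof.
move=> mf; rewrite (_ : (fun t => _) = fst \o (@cvec_coord R n i \o f))//.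
apply: measurableT_comp => //; apply: measurableT_comp => //.
exact: measurable_cvec_coord.
Qed.

Lemma measurable_Im_cvec n (f : T -> cvec R n) (i : 'I_n) :
  measurable_fun setT f ->
  measurable_fun setT (fun t => complex.Im ((f t : 'cV[R[i]]_n) i 0) : R).
Proof.
move=> mf; rewrite (_ : (fun t => _) = snd \o (@cvec_coord R n i \o f))//.
apply: measurableT_comp => //; apply: measurableT_comp => //.
exact: measurable_cvec_coord.
Qed.

Lemma measurable_rdot n (f g : T -> cvec R n) :
  measurable_fun setT f -> measurable_fun setT g ->
  measurable_fun setT (fun t => rdot (f t) (g t)).
Proof.
move=> mf mg; under eq_fun do rewrite rdotE.
apply: measurable_sum => i; apply: measurable_funD; apply: measurable_funM.
- exact: measurable_Re_cvec.
- exact: measurable_Re_cvec.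
- exact: measurable_Im_cvec.
- exact: measurable_Im_cvec.
Qed.

Lemma measurable_mulmx m n (A : 'M[R[i]]_(m, n)) (f : T -> cvec R n) :
  measurable_fun setT f ->
  measurable_fun setT (fun t => A *m (f t : 'cV[R[i]]_n) : cvec R m).
Proof.
move=> mf; apply: measurable_fun_cvec => i; apply: measurable_fun_pair.
- rewrite (_ : (fun _ => _) = fun t => rdot ((row i A)^t*) (f t)); last first.
    by apply/funext => t; rewrite /rdot trmxCK -row_mul !mxE.
  exact: measurable_rdot.
(* Multiplying the left vector by i turns the real part of the product into its imaginary part. *)
- rewrite (_ : (fun _ => _) = fun t => rdot ('i%C *: (row i A)^t*) (f t)); last first.
    apply/funext => t; rewrite /rdot /cvec_coord /=.
    rewrite linearZ map_mxZ trmxCK -scalemxAl -row_mul !mxE /=.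
    by case: (\sum_j _) => a b /=; ring.
  exact: measurable_rdot.
Qed.

Lemma measurable_rdot_mulmx n (A : 'M[R[i]]_n) (f : T -> cvec R n) :
  measurable_fun setT f ->
  measurable_fun setT (fun t => rdot (f t) (A *m (f t : 'cV[R[i]]_n))).
Proof. by move=> mf; apply: measurable_rdot => //; exact: measurable_mulmx. Qed.

End measurability.

Section gaussian_integral.
Context {R : realType}.

(** By construction the measure is the pushforward of a product, so this is Tonelli with the first
    complex coordinate integrated innermost. *)
Lemma integral_cvecS n (f : cvec R n.+1 -> \bar R) :
  measurable_fun setT f -> (forall z, 0 <= f z)%E ->
  (\int[lebesgue_cvec n.+1]_z f z =
   \int[lebesgue_cvec n]_v \int[lebesgue_plane]_p f (cvec_cons (p, v)))%E.
Proof.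
move=> mf f0.
have -> : (\int[lebesgue_cvec n.+1]_z f z =
    \int[pushforward (lebesgue_plane \x lebesgue_cvec n) (@cvec_cons R n)]_z f z)%E.
  by [].
rewrite ge0_integral_pushforward//; last exact: measurable_cvec_cons.
rewrite preimage_setT fubini_tonelli2//.
  by apply: measurableT_comp => //; exact: measurable_cvec_cons.
by move=> x; exact: f0.
Qed.

Lemma rdot_cV1 (x y x' y' : R) : rdot (const_mx (x +i* y) : 'cV_1) (const_mx (x' +i* y'))
  = x * x' + y * y'.
Proof. by rewrite rdotE big_ord1 !mxE. Qed.

(* Integrating out the first coordinate leaves a Gaussian integral for the
   Schur complement. *)
Lemma integral_cgauss n (A : 'M[R[i]]_n) (b c : 'cV[R[i]]_n) :
  posdefmx A -> A *m c = b ->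
  (\int[lebesgue_cvec n]_z (expR (2 * rdot b z - rdot z (A *m z)))%:E)%E =
  (pi ^+ n / complex.Re (\det A) * expR (rdot b c))%:E.
Proof.
elim: n A b c => [A b c _ _|n IH A b c].
  rewrite /= integral_dirac//; last first.
    apply/measurable_EFinP; apply: measurableT_comp => //; apply: measurable_funB.
      by apply: measurable_funM => //; apply: measurable_rdot => //; exact: measurable_id.
    by apply: measurable_rdot_mulmx; exact: measurable_id.
  by rewrite diracT mul1e det_mx00 expr0 divr1 mul1r !rdotE !big_ord0 mulr0 subr0.
move=> Apd; have [a [r [S [a0 Spd AE ->]]]] := @posdefmx_schur R n A Apd => Ac.
pose b1 : 'cV_1 := usubmx (b : 'cV_(1 + n)); pose b2 := dsubmx (b : 'cV_(1 + n)).
pose c1 : 'cV_1 := usubmx (c : 'cV_(1 + n)); pose c2 := dsubmx (c : 'cV_(1 + n)).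
have bE : b = col_mx b1 b2 by rewrite -[LHS](@vsubmxK _ 1).
have cE : c = col_mx c1 c2 by rewrite -[LHS](@vsubmxK _ 1).
(* The same equation at dimension [1 + n], where block products apply. *)
have Abc : @mulmx R[i] (1 + n) (1 + n) 1 A c = b by [].
rewrite AE bE cE mul_block_col in Abc; have [Ac1 Ac2] := eq_col_mx Abc.
rewrite mul_scalar_mx in Ac1.
(* The first block row of [A c = b], solved for [c1]. *)
have {}Ac1 : c1 = a^-1%:C *: (b1 - r *m c2).
  by rewrite -Ac1 addrK scalerA -rmorphM/= mulVf ?gt_eqF// scale1r.
(* Eliminating [c1] leaves the linear system of the Schur complement, as the induction hypothesis
   requires. *)
have Sc : S *m c2 = b2 - a^-1%:C *: (r^t* *m b1).
  rewrite -Ac2 Ac1 -scalemxAr mulmxBr scalerBr mulmxDl -scalemxAl -mulmxA.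
  by rewrite (addrC (S *m c2)) addrA subrK addrAC subrr add0r.
rewrite integral_cvecS; last 2 first.
- apply/measurable_EFinP; apply: measurableT_comp => //; apply: measurable_funB.
    by apply: measurable_funM => //; apply: measurable_rdot => //; exact: measurable_id.
  by apply: measurable_rdot_mulmx; exact: measurable_id.
- by move=> z; rewrite lee_fin expR_ge0.
(* [w v] is the linear coefficient of the first coordinate once the others are fixed to [v]; [k] is
   what the plane integral contributes independently of [v]. *)
pose w (v : 'cV[R[i]]_n) := b1 - r *m v.
pose k := pi / a * expR (rdot b1 b1 / a).
have k0 : 0 <= k by rewrite mulr_ge0 ?expR_ge0 ?divr_ge0 ?pi_ge0 ?ltW.
under eq_integral => v _.
  under eq_integral => p _.
    (* The term in [rdot b1 b1 - rdot (w v) (w v)] anticipates the plane integral, whose factor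
       [expR (rdot (w v) (w v) / a)] it cancels. *)
    rewrite (_ : expR _ =
        expR (2 * rdot (b2 - a^-1%:C *: (r^t* *m b1)) v - rdot v (S *m v)
              + a^-1 * (rdot b1 b1 - rdot (w v) (w v))) *
        expR (2 * (complex.Re (w v 0 0) * p.1 + complex.Im (w v 0 0) * p.2)
              - a * (p.1 ^+ 2 + p.2 ^+ 2))); last first.
      rewrite -expRD; congr expR; set z1 : 'cV_1 := const_mx (p.1 +i* p.2).
      have z1E : rdot z1 z1 = p.1 ^+ 2 + p.2 ^+ 2 by rewrite rdot_cV1 -!expr2.
      have wz1 : rdot (w v) z1 = complex.Re (w v 0 0) * p.1 + complex.Im (w v 0 0) * p.2.
        by rewrite rdotE big_ord1 !mxE.
      have -> : rdot b (cvec_cons (p, v)) = rdot b1 z1 + rdot b2 v.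
        by rewrite bE -rdot_col_mx.
      have -> : rdot (cvec_cons (p, v)) (A *m cvec_cons (p, v)) =
          a * rdot z1 z1 + 2 * rdot (r *m v) z1 + rdot v (S *m v)
          + a^-1 * rdot (r *m v) (r *m v).
        transitivity (rdot (col_mx z1 v) (@mulmx R[i] (1 + n) (1 + n) 1 A (col_mx z1 v))).
          by [].
        rewrite AE mul_block_col rdot_col_mx mul_scalar_mx mulmxDl -scalemxAl -mulmxA.
        rewrite !rdotDr !rdotZr (rdot_mulmx (r^t*) v) (rdot_mulmx (r^t*) v) trmxCK.
        rewrite (rdotC z1 (r *m v)).
        move: (rdot _ _) (rdot _ _) (rdot _ _) (rdot _ _) => t1 t2 t3 t4; ring.
      rewrite -z1E -wz1 /w !rdotBl !rdotBr rdotZl (rdotC (r^t* *m b1)).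
      rewrite (rdot_mulmx (r^t*)) trmxCK (rdotC (r *m v) b1).
      move: (rdot b1 b1) (rdot b2 v) (rdot b1 (r *m v)) (rdot (r *m v) (r *m v)).
      move: (rdot z1 z1) (rdot b1 z1) (rdot (r *m v) z1) (rdot v (S *m v)).
      by move=> *; field; rewrite gt_eqF.
    rewrite EFinM.
  over.
  rewrite ge0_integralZl//=; last first.
    apply/measurable_EFinP; apply: measurableT_comp => //.
    by apply: measurable_funB; apply: measurable_funM => //;
      apply: measurable_funD => //; apply: measurable_funM => //.
  rewrite integral_expR_quadratic_plane// -EFinM.
  rewrite [X in X%:E](_ : _ = k * expR (2 * rdot (b2 - a^-1%:C *: (r^t* *m b1)) v
                                        - rdot v (S *m v))); last first.
    have -> : complex.Re (w v 0 0) ^+ 2 + complex.Im (w v 0 0) ^+ 2 = rdot (w v) (w v).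
      by rewrite rdotE big_ord1 -!expr2.
    rewrite /k mulrCA -!mulrA -!expRD; congr (_ * (_ * expR _)).
    move: (rdot (b2 - _) v) (rdot v _) (rdot b1 b1) (rdot (w v) (w v)) => *; ring.
  rewrite EFinM.
over.
rewrite ge0_integralZl//=; last first.
  apply/measurable_EFinP; apply: measurableT_comp => //; apply: measurable_funB.
    by apply: measurable_funM => //; apply: measurable_rdot => //; exact: measurable_id.
  by apply: measurable_rdot_mulmx; exact: measurable_id.
rewrite (IH _ _ c2)// -EFinM; congr EFin.
rewrite /k mulrACA -expRD ReZ exprSr; congr (_ * expR _).
  by rewrite invfM [LHS]mulrACA (mulrC pi).
have -> : rdot b c = rdot b1 c1 + rdot b2 c2 by rewrite bE cE -rdot_col_mx.
rewrite Ac1 rdotZr !rdotBr rdotBl rdotZl.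
rewrite (rdotC (r^t* *m b1)) (rdot_mulmx (r^t*)) trmxCK (rdotC (r *m c2)).
move: (rdot b1 b1) (rdot b2 c2) (rdot b1 (r *m c2)) => *.
by field; rewrite gt_eqF.
Qed.

End gaussian_integral.

(** * Rank-one matrices *)

Section rank_one.
Context {R : realType}.
Local Notation C := R[i].

Lemma adjmx_mul_cV n (u : 'cV[C]_n) : u^t* *m u = (rdot u u)%:C%:M.
Proof.
apply/matrixP => i j; rewrite !ord1 [RHS]mxE eqxx mulr1n.
apply/eqP; rewrite eq_complex /= eqxx /=; apply/eqP.
rewrite mxE (big_morph (@complex.Im R) (id1 := 0) (op1 := +%R))//; last first.
  by move=> [? ?] [? ?].
rewrite big1// => k _; rewrite !mxE; case: (u k 0) => a b /=.
by ring.
Qed.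

(** Cauchy-Schwarz for [u] and [z]: expand the nonnegative squared norm of [s z - u u^* z], where
    [s] is the squared norm of [u], and divide by [s]. *)
Lemma rdot_cauchy_schwarz n (u z : 'cV[C]_n) :
  rdot z (u *m u^t* *m z) <= rdot u u * rdot z z.
Proof.
set s := rdot u u; have [u0|u0] := eqVneq u 0.
  by rewrite u0 mul0mx mul0mx rdot0r /s u0 rdot0r mul0r.
have s0 : 0 < s by rewrite rdot_gt0.
rewrite -subr_ge0 -(pmulr_rge0 _ s0).
have := rdot_ge0 (s%:C *: z - u *m u^t* *m z).
rewrite rdotBl !rdotBr !rdotZl !rdotZr (rdotC (u *m u^t* *m z) z).
have -> : rdot (u *m u^t* *m z) (u *m u^t* *m z) = s * rdot z (u *m u^t* *m z).
  rewrite -mulmxA rdot_mulmx (mulmxA (u^t*) u).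
  rewrite adjmx_mul_cV mul_scalar_mx rdotZl; congr (_ * _).
  by rewrite (rdot_mulmx u).
by move=> H; apply: le_trans H _; rewrite le_eqVlt; apply/orP; left; apply/eqP; ring.
Qed.

(* Both sides are the determinant of [[1, u], [v, 1]]. *)
Lemma det_rank_one n (u : 'cV[C]_n) (v : 'rV[C]_n) :
  \det (1%:M - u *m v) = 1 - (v *m u) 0 0.
Proof.
transitivity (\det (block_mx 1%:M u v 1%:M)).
  have -> : block_mx 1%:M u v 1%:M =
      block_mx 1%:M u 0 1%:M *m block_mx (1%:M - u *m v) 0 v 1%:M.
    by rewrite mulmx_block !mul1mx !mul0mx !mulmx1 !add0r subrK.
  by rewrite det_mulmx det_ublock det_lblock !det1 !mul1r mulr1.
have -> : block_mx 1%:M u v 1%:M =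
    block_mx 1%:M 0 v 1%:M *m block_mx 1%:M u 0 (1%:M - v *m u).
  by rewrite mulmx_block !mul1mx !mul0mx !mulmx1 !addr0 addrC subrK.
rewrite det_mulmx det_ublock det_lblock !det1 !mul1r det_mx11.
by rewrite !mxE eqxx.
Qed.

End rank_one.

(** * Means, and their recovery from exponential moments *)

Section mean.
Context {R : realType} {d} {T : measurableType d} (P : probability T R).

(** Integrability is bundled with the value so that means can be added and scaled without side
    conditions. *)
Definition has_mean (f : T -> R) (m : R) : Prop :=
  P.-integrable setT (EFin \o f) /\ (\int[P]_w (f w)%:E)%E = m%:E.

Lemma has_mean_eq f g a b : f =1 g -> a = b -> has_mean f a -> has_mean g b.
Proof. by move=> /funext -> ->. Qed.

Lemma has_mean_cst m : has_mean (cst m) m.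
Proof.
split; first exact: finite_measure_integrable_cst.
have := integral_cst P measurableT m%:E; rewrite /= probability_setT mule1; exact.
Qed.

Lemma has_meanD f g a b : has_mean f a -> has_mean g b ->
  has_mean (fun w => f w + g w) (a + b).
Proof.
move=> [fi fa] [gi gb]; split.
  by have := integrableD measurableT fi gi; apply: eq_integrable.
under eq_integral do rewrite EFinD.
by rewrite integralD// fa gb.
Qed.

Lemma has_meanZ f a k : has_mean f a -> has_mean (fun w => k * f w) (k * a).
Proof.
move=> [fi fa]; split.
  by have := integrableZl measurableT k fi; apply: eq_integrable.
under eq_integral do rewrite EFinM.
by rewrite integralZl// fa.
Qed.

Lemma has_meanB f g a b : has_mean f a -> has_mean g b ->
  has_mean (fun w => f w - g w) (a - b).
Proof.
move=> fa /(has_meanZ (-1)) gb; have := has_meanD fa gb.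
by rewrite mulN1r; under eq_fun do rewrite mulN1r.
Qed.

Lemma has_mean_sum (I : Type) (r : seq I) (f : I -> T -> R) (m : I -> R) :
  (forall i, has_mean (f i) (m i)) ->
  has_mean (fun w => \sum_(i <- r) f i w) (\sum_(i <- r) m i).
Proof.
move=> fm; elim: r => [|i r IH].
  by rewrite big_nil; under eq_fun do rewrite big_nil; exact: has_mean_cst.
by rewrite big_cons; under eq_fun do rewrite big_cons; exact: has_meanD.
Qed.

(* Since 1 + u <= e^u, the mean mu of f satisfies h (mu - m) <= K h^2 for small
   h of either sign, so no differentiation under the integral sign is needed. *)
Lemma has_mean_mgf (f : T -> R) (m K e : R) : measurable_fun setT f -> 0 < e ->
  (forall h, `|h| <= e ->
    (\int[P]_w (expR (h * f w))%:E <= (1 + h * m + K * h ^+ 2)%:E)%E) ->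
  has_mean f m.
Proof.
move=> mf e0 fub.
have mexp h : measurable_fun setT (fun w => (expR (h * f w))%:E).
  by apply/measurable_EFinP; apply: measurableT_comp => //; exact: measurable_funM.
have exp_int h : `|h| <= e -> P.-integrable setT (EFin \o (fun w => expR (h * f w))).
  move=> he; apply/integrableP; split; first exact: mexp.
  under eq_integral do rewrite /= ger0_norm ?expR_ge0//.
  by rewrite (le_lt_trans (fub _ he))// ltry.
have fi : P.-integrable setT (EFin \o f).
  (* A dominating function for [f], since [e * |f|] is at most [expR (e * |f|)], which is one of the
     two summands. *)
  have e_int : P.-integrable setT
     (EFin \o (fun w => e^-1 * (expR (e * f w) + expR (- e * f w)))).
    have ee : `|e| <= e by rewrite gtr0_norm.
    have Nee : `|- e| <= e by rewrite normrN gtr0_norm.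
    have := integrableZl measurableT e^-1
      (integrableD measurableT (exp_int _ ee) (exp_int _ Nee)).
    by apply: eq_integrable.
  apply: le_integrable e_int => //; first exact/measurable_EFinP.
  move=> w _; rewrite /= lee_fin.
  have ew : 0 <= expR (e * f w) + expR (- e * f w) by rewrite addr_ge0 ?expR_ge0.
  rewrite [leRHS]ger0_norm; last by rewrite mulr_ge0 ?invr_ge0// ltW.
  rewrite ler_pdivlMl//.
  have := expR_ge1Dx (e * f w); have := expR_ge1Dx (- e * f w).
  have := expR_ge0 (e * f w); have := expR_ge0 (- e * f w).
  by rewrite mulNr; case: (ger0P (f w)) => _; lra.
split => //.
have ffin : (\int[P]_w (f w)%:E)%E \is a fin_num by exact: integrable_fin_num fi.
pose mu := fine (\int[P]_w (f w)%:E)%E.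
have muE : (\int[P]_w (f w)%:E)%E = mu%:E by rewrite /mu fineK.
have key h : `|h| <= e -> h * (mu - m) <= K * h ^+ 2.
  move=> he.
  have [li lE] : has_mean (fun w => 1 + h * f w) (1 + h * mu).
    by apply: has_meanD; [exact: has_mean_cst | exact: has_meanZ].
  have : (\int[P]_w (1 + h * f w)%:E <= \int[P]_w (expR (h * f w))%:E)%E.
    apply: le_integral => //; first exact: exp_int.
    by move=> w _; rewrite lee_fin expR_ge1Dx.
  rewrite lE => /le_trans /(_ (fub _ he)); rewrite lee_fin; lra.
rewrite muE; congr EFin; apply/eqP; rewrite -subr_eq0 -normr_eq0.
rewrite eq_le normr_ge0 andbT; apply/ler_addgt0Pl => t t0; rewrite addr0.
(* Small enough for [key] and for [|K| * h <= t]; the [+ 1] guards against [K = 0]. *)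
pose h := Num.min e (t / (`|K| + 1)).
have K1 : 0 < `|K| + 1 by rewrite ltr_wpDl.
have h0 : 0 < h by rewrite lt_min e0 divr_gt0.
(* [s] is a sign: applying [key] to [h] and to [- h] bounds the difference of the means on both
   sides. *)
have hab s : `|s| = 1 -> s * (mu - m) <= t.
  move=> s1; have := key (s * h); rewrite normrM s1 mul1r gtr0_norm// ge_min lexx => /(_ isT).
  have s2 : s ^+ 2 = 1 by rewrite -real_normK ?num_real// s1 expr1n.
  rewrite exprMn s2 mul1r (mulrC s) -mulrA expr2 (mulrCA K) ler_pM2l// => /le_trans; apply.
  have : `|K| * h <= t.
    have : h <= t / (`|K| + 1) by rewrite ge_min lexx orbT.
    rewrite ler_pdivlMr// => ht; rewrite (le_trans _ ht)// mulrC ler_pM2l//.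
    by rewrite lerDl.
  by apply: le_trans; rewrite ler_pM2r// ler_norm.
rewrite ler_norml; have := hab 1 (normr1 _); have := hab (-1) (normrN1 _).
by lra.
Qed.

End mean.

(** * Moments of complex Gaussian vectors *)

Section density.
Context {R : realType} {d} {T : measurableType d}.
Local Open Scope ereal_scope.
Import HBNNSimple.

(** The usual extension from sets: indicators by hypothesis, simple functions by linearity,
    nonnegative functions by monotone convergence. *)
Lemma ge0_integral_density (mu nu : {measure set T -> \bar R}) (g : T -> R)
    (f : T -> \bar R) :
  measurable_fun setT g -> (forall t, 0 <= g t)%R ->
  (forall A, measurable A -> nu A = \int[mu]_(t in A) (g t)%:E) ->
  measurable_fun setT f -> (forall t, 0 <= f t) ->
  \int[nu]_t f t = \int[mu]_t (f t * (g t)%:E).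
Proof.
move=> mg g0 nuE mf f0.
pose f_ := nnsfun_approx measurableT mf.
have fcvg t : EFin \o f_^~ t @ \oo --> f t by exact: cvg_nnsfun_approx.
have mf_ n : measurable_fun setT (fun t => (f_ n t)%:E).
  exact/measurable_EFinP/measurable_funP.
have mEg : measurable_fun setT (EFin \o g) by exact/measurable_EFinP.
have sfun (h : {nnsfun T >-> R}) :
    \int[nu]_t (h t)%:E = \int[mu]_t ((h t)%:E * (g t)%:E).
  rewrite integralT_nnsfun sintegralE.
  transitivity (\int[mu]_t \sum_(y \in range h)
      (y * \1_(h @^-1` [set y]) t)%:E * (g t)%:E); last first.
    apply: eq_integral => t _.
    rewrite -ge0_mule_fsuml => [|y]; last exact: nnfun_muleindic_ge0.
    by rewrite fsumEFin// -fimfunE.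
  rewrite ge0_integral_fsum//; last 2 first.
  - by move=> y; apply: emeasurable_funM => //; exact/measurable_EFinP/measurable_funM.
  - by move=> y t _; apply: mule_ge0; [exact: nnfun_muleindic_ge0|rewrite lee_fin].
  apply: eq_fsbigr => y /[!inE] -[t _ <-].
  have mh : measurable (h @^-1` [set h t]) by exact: measurable_funPTI.
  under eq_integral do rewrite EFinM -muleA.
  rewrite ge0_integralZl//; last 3 first.
  - by apply: emeasurable_funM => //; exact/measurable_EFinP.
  - by move=> u _; rewrite mule_ge0 ?lee_fin.
  - by rewrite lee_fin.
  congr (_ * _); rewrite nuE// integral_mkcond epatch_indic.
  by apply: eq_integral => u _; rewrite muleC.
transitivity (limn (fun n => \int[nu]_t (f_ n t)%:E)).
  rewrite -monotone_convergence//.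
  - by apply: eq_integral => t _; apply/esym/cvg_lim => //; exact: fcvg.
  - by move=> n t _; rewrite lee_fin.
  - by move=> t _ m n mn; rewrite lee_fin; exact/lefP/nd_nnsfun_approx.
under eq_fun do rewrite sfun.
rewrite -monotone_convergence//.
- apply: eq_integral => t _; apply/cvg_lim => //.
  by apply: cvgeZr => //; exact: fcvg.
- by move=> n; apply: emeasurable_funM.
- by move=> n t _; rewrite mule_ge0// lee_fin.
- move=> t _ m n mn; rewrite lee_wpmul2r// ?lee_fin//.
  exact/lefP/nd_nnsfun_approx.
Qed.

End density.

(** * Integration against the joint law of independent vectors *)

Section independence.
Context {R : realType} {d} {T : measurableType d} (P : probability T R).
Local Open Scope ereal_scope.

(** Independence says that the joint law agrees with the product of the laws on rectangles, so
    uniqueness of the product measure identifies the two; Tonelli then iterates the integral. *)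
Lemma ge0_integral_independent n m (X : {RV P >-> cvec R n}) (Y : {RV P >-> cvec R m})
    (F : cvec R n * cvec R m -> \bar R) :
  independent_RV X Y -> measurable_fun setT F -> (forall p, 0 <= F p) ->
  \int[P]_w F (X w, Y w) = \int[distribution P Y]_v \int[distribution P X]_u F (u, v).
Proof.
move=> XY mF F0.
have mZ : measurable_fun setT (fun w => (X w, Y w)).
  by apply: measurable_fun_pair; exact: measurable_funP.
pose Z : {RV P >-> (cvec R n * cvec R m)%type} := mfun_Sub (mem_set mZ).
transitivity (\int[distribution P Z]_p F p).
  by rewrite ge0_integral_distribution.
rewrite -(fubini_tonelli2 F mF F0).
apply: eq_measure_integral => A mA _; apply/esym.
apply: product_measure_unique => // B C mB mC.
Qed.

End independence.

Section CN_moments.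
Context {R : realType} {d} {T : measurableType d} (P : probability T R).

Lemma cn_density_scalar n (s : R) (z : 'cV[R[i]]_n) : 0 < s ->
  cn_density s%:C%:M z = (pi ^+ n * s ^+ n)^-1 * expR (- (rdot z z / s)).
Proof.
move=> s0; rewrite /cn_density invmx_scalar det_scalar -rmorphXn /= mulrC.
congr (_ * expR (- _)); rewrite mul_mx_scalar -scalemxAl mxE.
by rewrite -fmorphV ReZ mulrC.
Qed.

(** The exponent of the density merges with [B] into the quadratic form of [s^-1 - B], and
    [integral_cgauss] applies; the powers of [pi] cancel. *)
Lemma integral_CN_expR n (X : {RV P >-> cvec R n}) (s : R) (B : 'M[R[i]]_n)
    (b c : 'cV[R[i]]_n) : 0 < s -> is_CN X s%:C%:M ->
  posdefmx (s^-1%:C%:M - B) -> (s^-1%:C%:M - B) *m c = b ->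
  (\int[distribution P X]_z (expR (2 * rdot b z + rdot z (B *m z)))%:E)%E =
  ((s ^+ n * complex.Re (\det (s^-1%:C%:M - B)))^-1 * expR (rdot b c))%:E.
Proof.
move=> s0 XCN Apd Ac.
have cst_ge0 : 0 <= (pi ^+ n * s ^+ n)^-1 :> R.
  by rewrite invr_ge0 mulr_ge0// exprn_ge0 ?pi_ge0// ltW.
have mexp (F : 'M[R[i]]_n) : measurable_fun setT (fun z : cvec R n =>
    (expR (2 * rdot b z + rdot z (F *m z)))%:E).
  apply/measurable_EFinP; apply: measurableT_comp => //; apply: measurable_funD.
    by apply: measurable_funM => //; apply: measurable_rdot => //; exact: measurable_id.
  by apply: measurable_rdot_mulmx; exact: measurable_id.
rewrite (ge0_integral_density (mu := lebesgue_cvec n)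
    (g := fun z => cn_density s%:C%:M z))//.
- under eq_integral => z _.
    rewrite cn_density_scalar// -EFinM mulrCA -expRD.
    rewrite [X in _ * expR X](_ : _ =
        2 * rdot b z - rdot z ((s^-1%:C%:M - B) *m z)); last first.
      by rewrite mulmxBl mul_scalar_mx rdotBr rdotZr; ring.
    rewrite EFinM.
  over.
  rewrite ge0_integralZl//=; last first.
    under eq_fun do rewrite -rdotNr -mulNmx.
    exact: mexp.
  rewrite (integral_cgauss Apd Ac) -EFinM; congr EFin.
  rewrite mulrA; congr (_ * _); rewrite !invfM.
  by rewrite mulrACA mulVf ?mul1r// expf_neq0// gt_eqF// pi_gt0.
- under eq_fun do rewrite cn_density_scalar//.
  apply: measurable_funM => //; apply: measurableT_comp => //.
  apply: measurableT_comp => //; apply: measurable_funM => //.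
  by apply: measurable_rdot; exact: measurable_id.
- by move=> z; rewrite cn_density_scalar// mulr_ge0 ?expR_ge0.
Qed.

(** By Cauchy-Schwarz the rank-one term is at most [|h| * rdot u u * rdot z z], which the hypothesis
    keeps below [rdot z z / s], whatever the sign of [h]. *)
Lemma posdefmx_rank_one n (s h : R) (u : 'cV[R[i]]_n) : 0 < s ->
  `|h| * s * rdot u u < 1 -> posdefmx (s^-1%:C%:M - h%:C *: (u *m u^t*)).
Proof.
move=> s0 hs; split.
  by rewrite adjmxB adjmx_scalar adjmxZ adjmxM trmxCK.
move=> z z0; rewrite mulmxBl mul_scalar_mx -scalemxAl rdotBr !rdotZr subr_gt0.
have zz : 0 < rdot z z by rewrite rdot_gt0.
apply: (@le_lt_trans _ _ (`|h| * rdot z (u *m u^t* *m z))).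
  apply: ler_wpM2r; last exact: ler_norm.
  by rewrite -mulmxA rdot_mulmx rdot_ge0.
apply: (@le_lt_trans _ _ (`|h| * (rdot u u * rdot z z))).
  by apply: ler_wpM2l => //; exact: rdot_cauchy_schwarz.
rewrite mulrA ltr_pM2r// -(ltr_pM2l s0) divff ?gt_eqF// (le_lt_trans _ hs)//.
by rewrite le_eqVlt; apply/orP; left; apply/eqP; ring.
Qed.

(** This is the moment generating function of an exponential variable of mean [s * rdot u u], the
    law of the squared modulus of [u^* X] for nonzero [u]. The determinant comes from
    [det_rank_one]. *)
Lemma integral_CN_rank_one n (X : {RV P >-> cvec R n}) (s h : R) (u : 'cV[R[i]]_n) :
  0 < s -> is_CN X s%:C%:M -> `|h| * s * rdot u u < 1 ->
  (\int[distribution P X]_z (expR (h * rdot z (u *m u^t* *m z)))%:E)%E =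
  ((1 - h * s * rdot u u)^-1)%:E.
Proof.
move=> s0 XCN hs; have Apd := posdefmx_rank_one s0 hs.
have A0 : (s^-1%:C%:M - h%:C *: (u *m u^t*)) *m (0 : 'cV[R[i]]_n) = 0 by rewrite mulmx0.
have expE z : 2 * rdot 0 z + rdot z (h%:C *: (u *m u^t*) *m z) = h * rdot z (u *m u^t* *m z).
  by rewrite rdot0l mulr0 add0r -scalemxAl rdotZr.
transitivity (\int[distribution P X]_z
    (expR (2 * rdot 0 z + rdot z (h%:C *: (u *m u^t*) *m z)))%:E)%E.
  by apply: eq_integral => z _; rewrite expE.
rewrite (integral_CN_expR s0 XCN Apd A0) rdot0l expR0 mulr1; congr (_^-1)%:E.
have -> : s^-1%:C%:M - h%:C *: (u *m u^t*) =
    s^-1%:C *: (1%:M - ((h * s)%:C *: u) *m u^t*).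
  rewrite scalerBr scalemx1 -scalemxAl scalerA -rmorphM; congr (_ - _%:C *: _).
  by rewrite mulrCA mulVf ?mulr1// gt_eqF.
rewrite detZ -rmorphXn ReZ exprVn mulrA divff ?mul1r ?expf_neq0 ?gt_eqF//.
rewrite det_rank_one -scalemxAr ReB mxE ReZ.
by [].
Qed.

(** After multiplication by [1 - t] the right side exceeds 1 by [t ^+ 2 * (1 - 2 * t)]. This is the
    second-order bound that [has_mean_mgf] consumes. *)
Lemma invr_1B_le (t : R) : `|t| <= 2^-1 -> (1 - t)^-1 <= 1 + t + 2 * t ^+ 2.
Proof.
move=> t2; have [t2a t2b] : -(1/2) <= t /\ t <= 1/2.
  by move: t2; rewrite ler_norml => /andP[]; lra.
have t0 : 0 < 1 - t by lra.
rewrite -[leLHS]mul1r ler_pdivrMr//.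
have : 0 <= t ^+ 2 * (1 - 2 * t) by rewrite mulr_ge0 ?sqr_ge0//; lra.
by nra.
Qed.

Lemma CN_mean_rank_one n (X : {RV P >-> cvec R n}) (s : R) (u : 'cV[R[i]]_n) :
  0 < s -> is_CN X s%:C%:M ->
  has_mean P (fun w => rdot (X w) (u *m u^t* *m X w)) (s * rdot u u).
Proof.
move=> s0 XCN; set v := s * rdot u u.
have v0 : 0 <= v by rewrite mulr_ge0 ?rdot_ge0// ltW.
(* The constant comes from [invr_1B_le] at [t = h * v]; the radius keeps [|h * v|] below one half,
   also when [v = 0]. *)
apply: (@has_mean_mgf _ _ _ _ _ _ (2 * v ^+ 2) (2^-1 / (v + 1))).
- by apply: measurable_rdot_mulmx; exact: measurable_funP.
- by rewrite divr_gt0// ltr_wpDl.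
move=> h; rewrite ler_pdivlMr ?ltr_wpDl// => hv.
have hv2 : `|h * v| <= 2^-1.
  by rewrite normrM (ger0_norm v0) (le_trans _ hv)// ler_wpM2l// lerDl.
have -> : (\int[P]_w (expR (h * rdot (X w) (u *m u^t* *m X w)))%:E =
    \int[distribution P X]_z (expR (h * rdot z (u *m u^t* *m z)))%:E)%E.
  rewrite ge0_integral_distribution//.
  apply/measurable_EFinP; apply: measurableT_comp => //; apply: measurable_funM => //.
  by apply: measurable_rdot_mulmx; exact: measurable_id.
rewrite (integral_CN_rank_one s0 XCN); last first.
  rewrite -mulrA -/v -(ger0_norm v0) -normrM (le_lt_trans hv2)//; lra.
rewrite lee_fin -mulrA -/v (le_trans (invr_1B_le hv2))//.
by rewrite le_eqVlt; apply/orP; left; apply/eqP; ring.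
Qed.

(** Integrating [X] out and then [Y] gives the generating function [1 / (1 - h ^+ 2 * v)]. It has no
    term linear in [h], so the mean is 0. *)
Lemma CN_cross_mean_rank_one n m (X : {RV P >-> cvec R n}) (Y : {RV P >-> cvec R m})
    (s t : R) (p : 'cV[R[i]]_m) (q : 'cV[R[i]]_n) :
  0 < s -> 0 < t -> is_CN X s%:C%:M -> is_CN Y t%:C%:M -> independent_RV X Y ->
  has_mean P (fun w => rdot (Y w) (p *m q^t* *m X w)) 0.
Proof.
move=> s0 t0 XCN YCN XY.
pose v := s * t * rdot q q * rdot p p / 4.
have v0 : 0 <= v by rewrite !(mulr_ge0, invr_ge0, rdot_ge0)// ltW.
(* The bound 1 gives [h ^+ 2 <= |h|]; the other bound then makes [h ^+ 2 * v] at most one half. *)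
pose e := Num.min 1 (2^-1 / (v + 1)).
have e0 : 0 < e by rewrite lt_min ltr01 divr_gt0// ltr_wpDl.
have mpq : measurable_fun setT (fun uv : cvec R n * cvec R m =>
    rdot uv.2 (p *m q^t* *m (uv.1 : 'cV_n))).
  by apply: measurable_rdot => //; exact: measurable_mulmx.
apply: (@has_mean_mgf _ _ _ _ _ _ (2 * v) e) => //.
  apply: measurable_rdot; first exact: measurable_funP.
  by apply: measurable_mulmx; exact: measurable_funP.
move=> h he.
have hv2 : `|h ^+ 2 * v| <= 2^-1.
  have /andP[h1 h2] : (`|h| <= 1) && (`|h| <= 2^-1 / (v + 1)).
    by rewrite !(le_trans he)// ge_min lexx ?orbT.
  rewrite normrM normrX (ger0_norm v0).
  rewrite ler_pdivlMr ?ltr_wpDl// in h2.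
  have : `|h| ^+ 2 * v <= `|h| * v by rewrite ler_wpM2r// expr2 ler_piMr.
  by move=> /le_trans; apply; rewrite (le_trans _ h2)// ler_wpM2l// lerDl.
rewrite (ge0_integral_independent (F := fun uv : cvec R n * cvec R m =>
    (expR (h * rdot uv.2 (p *m q^t* *m (uv.1 : 'cV_n))))%:E) XY)/=; last 2 first.
- by apply/measurable_EFinP; apply: measurableT_comp => //; exact: measurable_funM.
- by move=> uv; rewrite lee_fin expR_ge0.
pose g := h ^+ 2 * s * rdot q q / 4.
have g0 : 0 <= g by rewrite divr_ge0// mulr_ge0 ?rdot_ge0// mulr_ge0 ?sqr_ge0// ltW.
have gv : g * t * rdot p p = h ^+ 2 * v by rewrite /g /v; ring.
have s_pd : posdefmx (s^-1%:C%:M - 0 : 'M[R[i]]_n).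
  have := @posdefmx_rank_one n s 0 0 s0; rewrite mul0mx scaler0; apply.
  by rewrite normr0 !mul0r ltr01.
have inner (y : cvec R m) :
    (\int[distribution P X]_z (expR (h * rdot y (p *m q^t* *m (z : 'cV_n))))%:E)%E =
    (expR (g * rdot y (p *m p^t* *m y)))%:E.
  (* Half the coefficient of [z], to match the factor 2 in [integral_CN_expR]. *)
  pose b : 'cV_n := (h / 2)%:C *: (q *m p^t* *m y).
  have bE z : 2 * rdot b z + rdot z (0 *m z) = h * rdot y (p *m q^t* *m z).
    by rewrite mul0mx rdot0r addr0 rdotZl rdot_mulmx adjmxM trmxCK; field.
  have b_c : (s^-1%:C%:M - 0) *m (s%:C *: b) = b.
    by rewrite subr0 mul_scalar_mx scalerA -rmorphM mulVf ?scale1r// gt_eqF.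
  transitivity (\int[distribution P X]_z (expR (2 * rdot b z + rdot z (0 *m z)))%:E)%E.
    by apply: eq_integral => z _; rewrite bE.
  rewrite (integral_CN_expR s0 XCN s_pd b_c); congr EFin.
  rewrite subr0 det_scalar -rmorphXn/= exprVn divff ?expf_neq0 ?gt_eqF//.
  rewrite invr1 mul1r; congr expR.
  rewrite rdotZr /b rdotZl rdotZr -!mulmxA rdot_mulmx (mulmxA (q^t*) q) adjmx_mul_cV.
  by rewrite mul_scalar_mx rdotZl (rdot_mulmx p) /g; field.
rewrite (eq_integral (fun y : cvec R m => (expR (g * rdot y (p *m p^t* *m y)))%:E));
  last by move=> y _; exact: inner.
rewrite (integral_CN_rank_one t0 YCN); last first.
  by rewrite (ger0_norm g0) gv (le_lt_trans (ler_norm _))// (le_lt_trans hv2)//; lra.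
rewrite lee_fin gv (le_trans (invr_1B_le hv2))// mulr0 addr0.
(* Since [h ^+ 2 * v] is at most one half, the quartic remainder is absorbed by a second copy of
   [h ^+ 2 * v], whence the constant [2 * v]. *)
have : 2 * (h ^+ 2 * v) ^+ 2 <= h ^+ 2 * v.
  have w0 : 0 <= h ^+ 2 * v by rewrite mulr_ge0// sqr_ge0.
  rewrite ger0_norm// in hv2; rewrite expr2 mulrA -[leRHS]mul1r ler_wpM2r//; lra.
lra.
Qed.

End CN_moments.

(** * Quadratic forms of Gaussian vectors and the rate *)

Section CN_quadratic.
Context {R : realType} {d} {T : measurableType d} (P : probability T R).

(** A decomposition into rank-one terms, which carries the rank-one means over to arbitrary
    matrices. *)
Lemma sum_col_delta m n (C : 'M[R[i]]_(m, n)) :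
  C = \sum_j col j C *m (delta_mx j 0 : 'cV_n)^t*.
Proof.
apply/matrixP => i k; rewrite summxE (bigD1 k)//= big1 => [|j jk].
  by rewrite mxE big_ord1 !mxE !eqxx rmorph1 mulr1 addr0.
by rewrite mxE big_ord1 !mxE eq_sym (negbTE jk) rmorph0 mulr0.
Qed.

Lemma rdot_mulmx_sum m n (C : 'M[R[i]]_(m, n)) y x :
  rdot y (C *m x) = \sum_j rdot y (col j C *m (delta_mx j 0 : 'cV_n)^t* *m x).
Proof.
rewrite [in LHS](sum_col_delta C) mulmx_suml.
by rewrite (big_morph (rdot y) (rdotDr y) (rdot0r y)).
Qed.

Lemma CN_mean_quadratic n (X : {RV P >-> cvec R n}) (s : R) (C : 'M[R[i]]_n) :
  0 < s -> is_CN X s%:C%:M ->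
  has_mean P (fun w => rdot (X w) (C *m X w)) (s * complex.Re (\tr C)).
Proof.
move=> s0 XCN.
(* Polarization: the mixed form is half the difference between the rank-one form of [p + q] and
   those of [p] and [q]. Only real parts occur, so the real identity suffices. *)
have bilin (p q : 'cV[R[i]]_n) :
    has_mean P (fun w => rdot (X w) (p *m q^t* *m X w)) (s * rdot p q).
  have := has_meanZ 2^-1 (has_meanB (has_meanB (CN_mean_rank_one (p + q) s0 XCN)
    (CN_mean_rank_one p s0 XCN)) (CN_mean_rank_one q s0 XCN)).
  rewrite (_ : 2^-1 * _ = s * rdot p q); last first.
    by rewrite rdotDl !rdotDr (rdotC q p); field.
  congr has_mean; apply/funext => w.
  have adj (a b : 'cV[R[i]]_n) :
      rdot (X w) (a *m b^t* *m X w) = rdot (a^t* *m X w) (b^t* *m X w).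
    by rewrite -mulmxA (rdot_mulmx a).
  rewrite !adj adjmxD mulmxDl; move: (p^t* *m X w) (q^t* *m X w) => a b.
  by rewrite rdotDl !rdotDr (rdotC b a); field.
rewrite (_ : complex.Re (\tr C) =
    \sum_j rdot (col j C) (delta_mx j 0 : 'cV_n)); last first.
  rewrite /mxtrace Re_sum; apply: eq_bigr => j _.
  rewrite rdotE (bigD1 j)//= big1 => [|k kj].
    by rewrite !mxE !eqxx /= mulr1 mulr0 !addr0.
  by rewrite !mxE (negbTE kj) /= !mulr0 addr0.
rewrite mulr_sumr; under eq_fun do rewrite rdot_mulmx_sum.
by apply: has_mean_sum => j; exact: bilin.
Qed.

Lemma CN_cross_mean n m (X : {RV P >-> cvec R n}) (Y : {RV P >-> cvec R m})
    (s t : R) (C : 'M[R[i]]_(m, n)) :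
  0 < s -> 0 < t -> is_CN X s%:C%:M -> is_CN Y t%:C%:M -> independent_RV X Y ->
  has_mean P (fun w => rdot (Y w) (C *m X w)) 0.
Proof.
move=> s0 t0 XCN YCN XY; under eq_fun do rewrite rdot_mulmx_sum.
rewrite [X in has_mean _ _ X](_ : _ = \sum_(j < n) 0); last by rewrite big1.
apply: has_mean_sum => j; exact: CN_cross_mean_rank_one XCN YCN XY.
Qed.

End CN_quadratic.

(** * Closed form of the marginal of the detection model *)

Section marginal.
Context {R : realType}.

Lemma posdefmxZ n (k : R) (A : 'M[R[i]]_n) : 0 < k -> posdefmx A -> posdefmx (k%:C *: A).
Proof.
move=> k0 [Aherm Apos]; split; first by rewrite adjmxZ Aherm.
by move=> z z0; rewrite -scalemxAl rdotZr mulr_gt0// Apos.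
Qed.

Lemma posdefmx_1DZ m n (b : R) (A : 'M[R[i]]_(m, n)) : 0 <= b ->
  posdefmx (1%:M + b%:C *: (A^t* *m A)).
Proof.
move=> b0; split; first by rewrite adjmxD adjmx1 adjmxZ adjmxM trmxCK.
move=> z z0; rewrite mulmxDl mul1mx -scalemxAl rdotDr rdotZr.
rewrite ltr_wpDr ?rdot_gt0// mulr_ge0// -mulmxA rdot_mulmx trmxCK.
exact: rdot_ge0.
Qed.

Lemma posdefmx_unit n (A : 'M[R[i]]_n) : posdefmx A -> A \in unitmx.
Proof. by move=> /posdefmx_det; rewrite unitmxE unitfE; exact: lt0r_neq0. Qed.

Lemma posdefmx_Re_det n (A : 'M[R[i]]_n) : posdefmx A -> 0 < complex.Re (\det A).
Proof. by move=> /posdefmx_det; rewrite ltcE => /andP[]. Qed.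

Variables (M N : nat) (Es N0 : R) (Q : 'M[R[i]]_(M, N)) (L W : 'M[R[i]]_N).
Hypotheses (Es0 : 0 < Es) (N00 : 0 < N0).
Let Lp := W *m L.
Let F := wld_F N0 Q L W.
Let G := wld_G N0 L W.
Let D := 1%:M + (Es / N0)%:C *: (Lp^t* *m Lp).

Lemma ln_wld_cond (y : 'cV[R[i]]_M) (x : 'cV[R[i]]_N) :
  ln (wld_cond N0 Q L W y x) = 2 * rdot y (F *m x) - rdot x (G *m x).
Proof. by rewrite /wld_cond expRK /rdot !mulmxA. Qed.

(** Model and prior together have quadratic form [G + Es^-1 = Es^-1 D] and linear term [F^* y]; the
    prior's normalisation cancels the powers of [pi] and [Es] in the Gaussian integral. *)
Lemma wld_marginalE (y : 'cV[R[i]]_M) :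
  wld_marginal Es N0 Q L W y =
  (complex.Re (\det D))^-1 * expR (Es * rdot y (F *m invmx D *m F^t* *m y)).
Proof.
have Dpd : posdefmx D by apply: posdefmx_1DZ; rewrite ltW// divr_gt0.
have Apd : posdefmx (Es^-1%:C *: D) by apply: posdefmxZ => //; rewrite invr_gt0.
have Ac : (Es^-1%:C *: D) *m (Es%:C *: (invmx D *m (F^t* *m y))) = F^t* *m y.
  rewrite -scalemxAl -scalemxAr scalerA -rmorphM mulVf ?gt_eqF// scale1r.
  by rewrite mulKVmx// posdefmx_unit.
have k0 : 0 <= (pi ^+ N * Es ^+ N)^-1 :> R.
  by rewrite invr_ge0 mulr_ge0// exprn_ge0 ?pi_ge0// ltW.
rewrite /wld_marginal.
have integrandE z : wld_cond N0 Q L W y z * wld_prior Es z = (pi ^+ N * Es ^+ N)^-1 *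
    expR (2 * rdot (F^t* *m y) z - rdot z ((Es^-1%:C *: D) *m z)).
  rewrite /wld_cond /wld_prior mulrCA -expRD; congr (_ * expR _).
  rewrite -(mulmxA _ (wld_F _ _ _ _)) -(mulmxA _ (wld_G _ _ _)) -!/(rdot _ _) rdot_mulmx.
  rewrite -scalemxAl mulmxDl mul1mx rdotZr rdotDr -scalemxAl rdotZr.
  rewrite /wld_G -scalemxAl rdotZr -/Lp -/F; field.
  by rewrite !gt_eqF.
rewrite (eq_integral (fun z : cvec R N => ((pi ^+ N * Es ^+ N)^-1)%:E *
    (expR (2 * rdot (F^t* *m y) z - rdot z ((Es^-1%:C *: D) *m z)))%:E)%E); last first.
  by move=> z _; rewrite integrandE EFinM.
rewrite ge0_integralZl//=; last first.
  apply/measurable_EFinP; apply: measurableT_comp => //; apply: measurable_funB.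
    by apply: measurable_funM => //; apply: measurable_rdot => //; exact: measurable_id.
  by apply: measurable_rdot_mulmx; exact: measurable_id.
rewrite (integral_cgauss Apd Ac) /= mulrA; congr (_ * expR _); last first.
  by rewrite rdotZr -!mulmxA (rdot_mulmx F).
rewrite detZ -rmorphXn ReZ exprVn !invfM invrK.
rewrite mulrACA mulVf ?mul1r ?expf_neq0 ?gt_eqF ?pi_gt0//.
by rewrite mulrA mulVf ?mul1r// expf_neq0// gt_eqF.
Qed.

Lemma ln_wld_marginal (y : 'cV[R[i]]_M) :
  ln (wld_marginal Es N0 Q L W y) =
  Es * rdot y (F *m invmx D *m F^t* *m y) - ln (complex.Re (\det D)).
Proof.
have Dpd : posdefmx D by apply: posdefmx_1DZ; rewrite ltW// divr_gt0.
have D0 := posdefmx_Re_det Dpd.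
rewrite wld_marginalE lnM ?posrE ?expR_gt0 ?invr_gt0// expRK lnV ?posrE//.
by rewrite addrC.
Qed.

End marginal.

(** * Trace identities and the final rate *)

(* Push-through: (I + b A A^dagger)^-1 A = A (I + b A^dagger A)^-1. *)
Lemma mxtrace_push_through (K : numClosedFieldType) n (b : K) (A B D E : 'M[K]_n) :
  D = 1%:M + b *: (A^t* *m A) -> E = 1%:M + b *: (A *m A^t*) ->
  D \in unitmx -> E \in unitmx ->
  \tr (b *: (A^t* *m A)) - \tr ((b *: (A^t* *m A)) *m invmx D *m (b *: (A^t* *m A)))
  - \tr (b *: (invmx D *m (A^t* *m B *m A))) =
  \tr (1%:M - B) - \tr ((1%:M - B) *m invmx E).
Proof.
move=> DE EE Du Eu.
have DK : invmx D *m (b *: (A^t* *m A)) = 1%:M - invmx D.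
  have -> : b *: (A^t* *m A) = D - 1%:M by rewrite DE addrAC subrr add0r.
  by rewrite mulmxBr (mulVmx Du) mulmx1.
have EA : invmx E *m A = A *m invmx D.
  have EAD : E *m A = A *m D.
    by rewrite EE DE mulmxDl mulmxDr mul1mx mulmx1 -scalemxAl -scalemxAr mulmxA.
  by rewrite -[LHS](mulmxK Du) -(mulmxA (invmx E)) -EAD (mulKmx Eu).
have AA : b *: (A *m invmx D *m A^t*) = 1%:M - invmx E.
  rewrite -EA -mulmxA scalemxAr.
  have -> : b *: (A *m A^t*) = E - 1%:M by rewrite EE addrAC subrr add0r.
  by rewrite mulmxBr (mulVmx Eu) mulmx1.
(* By [DK] the difference is the trace of [b A^* A D^-1]; moving [A^*] around cyclically produces
   the left side of [AA]. *)
have -> : \tr (b *: (A^t* *m A)) - \tr ((b *: (A^t* *m A)) *m invmx D *m (b *: (A^t* *m A)))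
    = \tr (1%:M - invmx E).
  rewrite -mulmxA DK -linearB/= mulmxBr mulmx1 opprB addrC subrK.
  rewrite -AA -!scalemxAl !mxtraceZ; congr (_ * _).
  by rewrite [RHS]mxtrace_mulC mulmxA.
have -> : \tr (b *: (invmx D *m (A^t* *m B *m A))) = \tr (B *m (1%:M - invmx E)).
  rewrite -AA -scalemxAr !mxtraceZ; congr (_ * _).
  by rewrite [LHS]mxtrace_mulC -!mulmxA [LHS]mxtrace_mulC -!mulmxA.
(* What remains is the expansion of [(1 - B)(1 - E^-1)]. *)
rewrite -!linearB/=; congr (\tr _).
rewrite mulmxBr mulmx1 mulmxBl mul1mx; move: (invmx E) (B *m invmx E) => X Y.
by rewrite !opprB addrACA [RHS]addrACA (addrC (- X)).
Qed.

(* A is L_p. The trace of I - W W^dagger is the only place where the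
   normalisation of the puncturing enters. *)
Lemma wld_trace_identity (K : numClosedFieldType) M n (es n0 : K)
    (H Q F : 'M[K]_(M, n)) (L W A D E : 'M[K]_n) :
  n0 != 0 -> Num.conj n0 = n0 -> H = Q *m L -> Q^t* *m Q = 1%:M -> A = W *m L ->
  F = n0^-1 *: (Q *m W^t* *m A) ->
  D = 1%:M + (es / n0) *: (A^t* *m A) -> E = 1%:M + (es / n0) *: (A *m A^t*) ->
  D \in unitmx -> E \in unitmx -> \tr (1%:M - W *m W^t*) = 0 ->
  es * \tr (n0^-1 *: (A^t* *m A))
  - es * (es * \tr (H^t* *m (F *m invmx D *m F^t*) *m H)
          + n0 * \tr (F *m invmx D *m F^t*)) =
  - \tr ((1%:M - W *m W^t*) *m invmx E).
Proof.
move=> n00 n0r HQL QQ AE FE DE EE Du Eu W0.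
have n0Vr : Num.conj n0^-1 = n0^-1 by rewrite fmorphV /= n0r.
have HF : H^t* *m F = n0^-1 *: (A^t* *m A).
  rewrite HQL FE AE -scalemxAr !adjmxM -!mulmxA (mulmxA (Q^t*) Q) QQ mul1mx.
  by rewrite !mulmxA.
have FadjE : F^t* = n0^-1 *: (A^t* *m W *m Q^t*).
  rewrite FE linearZ/= map_mxZ/= !adjmxM trmxCK mulmxA.
  congr (_ *: _); exact: n0Vr.
have FH : F^t* *m H = n0^-1 *: (A^t* *m A).
  by rewrite FadjE HQL AE -scalemxAl -!mulmxA (mulmxA (Q^t*) Q) QQ mul1mx.
(* Here [W *m W^t*] survives in the middle; it plays the part of [B] in the push-through identity
   and enters only through the noise. *)
have FF : F^t* *m F = (n0^-1 * n0^-1) *: (A^t* *m (W *m W^t*) *m A).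
  rewrite FadjE FE -scalemxAl -scalemxAr scalerA; congr (_ *: _).
  by rewrite -!mulmxA (mulmxA (Q^t*) Q) QQ mul1mx.
have := mxtrace_push_through (W *m W^t*) DE EE Du Eu; rewrite W0 sub0r => <-.
have -> : H^t* *m (F *m invmx D *m F^t*) *m H =
    (n0^-1 * n0^-1) *: ((A^t* *m A) *m invmx D *m (A^t* *m A)).
  rewrite !mulmxA HF -!mulmxA FH -scalemxAl -!scalemxAr scalerA.
  by rewrite !mulmxA.
have -> : \tr (F *m invmx D *m F^t*) =
    (n0^-1 * n0^-1) * \tr (invmx D *m (A^t* *m (W *m W^t*) *m A)).
  by rewrite -(mulmxA F) [LHS]mxtrace_mulC -(mulmxA (invmx D)) FF -scalemxAr mxtraceZ.
rewrite -!scalemxAl -!scalemxAr !mxtraceZ.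
move: (\tr _) (\tr _) (\tr _) => t u v.
by field.
Qed.

(** The lower block is [Omega X X^* Omega] with [X = S^-1], and [Omega] holds the inverse square
    roots of the diagonal of [X X^*]. These are nonzero because [X] is invertible. *)
Lemma puncturing_mx_diag (R : realType) nu k (L : 'M[R[i]]_(nu + k)) i :
  is_trig_mx L -> (forall i, 0 < L i i) ->
  (puncturing_mx L *m (puncturing_mx L)^t*) i i = 1.
Proof.
move=> /is_trig_mxP Ltrig Lpos; pose S := drsubmx L; pose X := invmx S.
have Strig : is_trig_mx S.
  apply/is_trig_mxP => a b ab; rewrite !mxE; apply: Ltrig => /=.
  by rewrite ltn_add2l.
have Su : S \in unitmx.
  rewrite unitmxE det_trig// unitfE; apply/prodf_neq0 => a _.
  by rewrite !mxE gt_eqF.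
have XX a : 0 < (X *m X^t*) a a.
  have -> : (X *m X^t*) a a = (rdot ((row a X)^t*) ((row a X)^t*))%:C.
    have := adjmx_mul_cV ((row a X)^t*); rewrite trmxCK => /matrixP/(_ 0 0).
    rewrite [X in _ = X -> _]mxE eqxx mulr1n => <-.
    by rewrite !mxE; apply: eq_bigr => j _; rewrite !mxE.
  rewrite ltcR rdot_gt0; apply/eqP => /(congr1 (fun A => A^t*)).
  rewrite trmxCK trmx0 map_mx0 => rX.
  (* A zero row of [X] would give a zero row of [X S = 1]. *)
  have := congr1 (row a) (mulVmx Su); rewrite row_mul rX mul0mx.
  move=> /matrixP/(_ 0 a); rewrite !mxE eqxx => /eqP.
  by rewrite eq_sym oner_eq0.
rewrite /puncturing_mx -/S -/X tr_block_mx map_block_mx mulmx_block.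
rewrite !trmx0 !map_mx0 !mulmx0 !mul0mx !addr0 !add0r adjmx1 mulmx1.
case: (split_ordP i) => a ->; first by rewrite block_mxEul mxE eqxx.
rewrite block_mxEdr adjmxM -mulmxA (mulmxA X) mul_diag_mx.
rewrite tr_diag_mx map_diag_mx mul_mx_diag.
move: (X *m X^t*) (XX a) => Z Zaa; rewrite !mxE.
have w0 : sqrtC (Z a a) != 0 by rewrite sqrtC_eq0 gt_eqF.
have wJ : Num.conj (sqrtC (Z a a))^-1 = (sqrtC (Z a a))^-1.
  by rewrite fmorphV /= geC0_conj// sqrtC_ge0 ltW.
rewrite [X in _ * (_ * X)](_ : _ = (sqrtC (Z a a))^-1); last exact: wJ.
by rewrite -{2}[Z a a]sqrtCK expr2 mulfK// mulVf.
Qed.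

(** Both logarithms are quadratic in [(x, n)] up to a constant, so the mean lemmas apply term by
    term and the cross terms vanish. *)
Lemma wld_rateE (R : realType) M N (H Q : 'M[R[i]]_(M, N)) (L W : 'M[R[i]]_N)
    (Es N0 : R) (d : measure_display) (T : measurableType d) (P : probability T R)
    (x : {RV P >-> cvec R N}) (n : {RV P >-> cvec R M}) :
  let F := wld_F N0 Q L W in
  let D := 1%:M + (Es / N0)%:C *: ((W *m L)^t* *m (W *m L)) in
  let B := F *m invmx D *m F^t* in
  0 < Es -> 0 < N0 -> H = Q *m L -> Q^t* *m Q = 1%:M ->
  is_CN x (Es%:C%:M) -> is_CN n (N0%:C%:M) -> independent_RV x n ->
  wld_rate Es N0 Q L W P (fun w => H *m x w + n w) x =
  (Es * complex.Re (\tr (wld_G N0 L W))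
   - (Es * (Es * complex.Re (\tr (H^t* *m B *m H)) + N0 * complex.Re (\tr B))
      - ln (complex.Re (\det D))))%:E.
Proof.
move=> F D B Es0 N00 HE QQ xCN nCN xn; pose G := wld_G N0 L W.
have HF : H^t* *m F = G.
  rewrite HE /F /G /wld_F /wld_G -scalemxAr !adjmxM -!mulmxA (mulmxA (Q^t*) Q) QQ.
  by rewrite mul1mx !mulmxA.
have mean_cond : has_mean P (fun w => ln (wld_cond N0 Q L W (H *m x w + n w) (x w)))
    (Es * complex.Re (\tr G)).
  have mG := CN_mean_quadratic G Es0 xCN.
  have mF := CN_cross_mean F Es0 N00 xCN nCN xn.
  (* As [H^* F = G], the signal contributes twice the mean of the [G] form, of which one copy is
     subtracted. *)
  apply: has_mean_eq (has_meanB (has_meanZ 2 (has_meanD mG mF)) mG); last by ring.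
  move=> w; rewrite ln_wld_cond -/F -/G rdotDl -HF -mulmxA (rdot_mulmx (H^t*)) trmxCK.
  by [].
have mean_marginal : has_mean P (fun w => ln (wld_marginal Es N0 Q L W (H *m x w + n w)))
    (Es * (Es * complex.Re (\tr (H^t* *m B *m H)) + N0 * complex.Re (\tr B))
     - ln (complex.Re (\det D))).
  have mx := CN_mean_quadratic (H^t* *m B *m H) Es0 xCN.
  have mn := CN_mean_quadratic B N00 nCN.
  have mxn := CN_cross_mean (B *m H) Es0 N00 xCN nCN xn.
  have mnx := CN_cross_mean (B^t* *m H) Es0 N00 xCN nCN xn.
  have mB := has_meanD (has_meanD mx (has_meanD mxn mnx)) mn.
  apply: has_mean_eq (has_meanB (has_meanZ Es mB) (has_mean_cst P (ln (complex.Re (\det D))))).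
    by move=> w; rewrite ln_wld_marginal// -/F -/D -/B rdot_quadratic_affine.
  by rewrite !addr0.
rewrite /wld_rate unlock (proj2 mean_cond) (proj2 mean_marginal).
by rewrite EFinB.
Qed.

(** N is split as [nu + k] so that the block partition of L is typed. The real parts lose nothing: a
    positive definite matrix has a positive determinant, and the trace of a product of two Hermitian
    matrices is real. *)
Theorem theorem1 (R : realType) (M nu k : nat)
    (nu_gt0 : (0 < nu)%N) (k_gt0 : (0 < k)%N) (le_NM : (nu + k <= M)%N)
    (H : 'M[R[i]]_(M, nu + k)) (rankH : \rank H = (nu + k)%N)
    (Es N0 : R) (Es_gt0 : 0 < Es) (N0_gt0 : 0 < N0)
    (Q : 'M[R[i]]_(M, nu + k)) (L : 'M[R[i]]_(nu + k)) (HQL : thin_QL H Q L)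
    (d : measure_display) (T : measurableType d) (P : probability T R)
    (x : {RV P >-> cvec R (nu + k)}) (n : {RV P >-> cvec R M})
    (x_CN : is_CN x (Es%:C%:M)) (n_CN : is_CN n (N0%:C%:M))
    (xn_indep : independent_RV x n) :
  let beta := Es / N0 in
  let Wp := puncturing_mx L in
  let Lp := Wp *m L in
  let y := fun w : T => H *m x w + n w in
  wld_rate Es N0 Q L Wp P y x =
  (ln (complex.Re (\det (1%:M + beta%:C *: (Lp^t* *m Lp))))
   - complex.Re (\tr ((1%:M - Wp *m Wp^t*) *m
                      invmx (1%:M + beta%:C *: (Lp *m Lp^t*)))))%:E.
Proof.
move=> beta Wp Lp y; have [HE QQ Ltrig Lpos] := HQL.
have W0 : \tr (1%:M - Wp *m Wp^t*) = 0.
  rewrite linearB/= mxtrace1 {1}/mxtrace (eq_bigr (fun=> 1)); last first.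
    by move=> i _; exact: puncturing_mx_diag.
  by rewrite sumr_const card_ord subrr.
have beta0 : 0 <= beta by rewrite ltW// divr_gt0.
have betaC : beta%:C = Es%:C / N0%:C by rewrite rmorphM fmorphV.
have N0C : N0%:C != 0 by rewrite fmorph_eq0 gt_eqF.
have Dpd := posdefmx_1DZ Lp beta0.
have Epd : posdefmx (1%:M + beta%:C *: (Lp *m Lp^t*)).
  by have := posdefmx_1DZ (Lp^t*) beta0; rewrite trmxCK.
have := wld_trace_identity (es := Es%:C) (F := wld_F N0 Q L Wp) N0C (conjC_real N0) HE QQ
  (erefl Lp).
rewrite -betaC -fmorphV.
move=> /(_ _ _ erefl erefl erefl (posdefmx_unit Dpd) (posdefmx_unit Epd) W0).
(* The trace identity holds over the complex field; its real part is the equation between the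
   means. *)
move=> /(congr1 (@complex.Re R)); rewrite ReN ReB !ReZ ReD !ReZ => trE.
rewrite (wld_rateE Wp Es_gt0 N0_gt0 HE QQ x_CN n_CN xn_indep); congr EFin.
rewrite opprB addrCA; congr (_ + _).
exact: trE.
Qed.
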